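(* Let $G$ be a $k$-regular graph on $n$ vertices, and let $L(G)$ be its line graph. Then $mo(L(G))\ge \dfrac{n(k-1)}{4}$.
   Context: The line graph $L(G)$ has the edges of $G$ as vertices, two being adjacent iff they share an endpoint. For a graph with threshold assignment $\tau$, a set $M$ of vertices is a $\tau$-monopoly if every vertex $v\notin M$ has at least $\tau(v)$ neighbors in $M$. $mo(L(G))$ denotes the minimum size of a $\tau$-monopoly of $L(G)$ for the simple majority threshold $\tau(v)=d_{L(G)}(v)/2$; for $G$ $k$-regular this is $\tau(v)=k-1$ for every vertex $v$ of $L(G)$. *)

(* Defs.v *)
From mathcomp Require Import all_boot all_order all_algebra.
Set Implicit Arguments.
Unset Strict Implicit.
Unset Printing Implicit Defensive.
Import Order.TTheory GRing.Theory Num.Theory.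
Local Open Scope ring_scope.

Record sgraph := SGraph {
  vert :> finType;
  adj : rel vert;
  adj_sym : symmetric adj;
  adj_irr : irreflexive adj
}.

Definition nbhd (G : sgraph) (v : G) : {set G} := [set w | adj v w].

Definition deg (G : sgraph) (v : G) : nat := #|nbhd v|.

Definition regular (G : sgraph) (k : nat) : Prop := forall v : G, deg v = k.

Definition edges (G : sgraph) : {set {set G}} :=
  [set [set p.1; p.2] | p in [set p : G * G | adj p.1 p.2]].

Section LineGraph.
Variable G : sgraph.

Definition edge : finType := {e : {set G} | e \in edges G}.

Definition line_adj : rel edge :=
  fun e f => (e != f) && (val e :&: val f != set0).

Lemma line_adj_sym : symmetric line_adj.
Proof. by move=> e f; rewrite /line_adj eq_sym setIC. Qed.

Lemma line_adj_irr : irreflexive line_adj.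
Proof. by move=> e; rewrite /line_adj eqxx. Qed.

Definition line_graph : sgraph := SGraph line_adj_sym line_adj_irr.

End LineGraph.

(* Thresholds are rational, so that half of an odd degree is not rounded. *)
Definition monopoly (G : sgraph) (tau : G -> rat) (M : {set G}) : bool :=
  [forall v, (v \notin M) ==> (tau v <= #|nbhd v :&: M|%:R)].

Lemma monopolyT (G : sgraph) (tau : G -> rat) : monopoly tau setT.
Proof. by apply/forallP => v; rewrite in_setT. Qed.

Definition min_monopoly (G : sgraph) (tau : G -> rat) : nat :=
  #|[arg min_(M < [set: G] | monopoly tau M) #|M| ]|.

Lemma min_monopolyP (G : sgraph) (tau : G -> rat) :
  (exists2 M, monopoly tau M & #|M| = min_monopoly tau) /\
  (forall M, monopoly tau M -> (min_monopoly tau <= #|M|)%N).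
Proof.
rewrite /min_monopoly; case: arg_minnP => [|M monM minM]; first exact: monopolyT.
by split=> //; exists M.
Qed.

Definition majority (G : sgraph) (v : G) : rat := (deg v)%:R / 2.

Definition mo (G : sgraph) : nat := min_monopoly (@majority G).

(* Main.v *)
(** Let [d v] be the number of edges of a majority monopoly [M] at [v].  Every
    edge [uv] outside [M] satisfies [d u + d v >= k - 1].  Summing over the
    edges outside [M], each vertex [v] is counted [k - d v] times, so
    [\sum_v (k - d v) (d v - (k - 1) / 2) >= 0].  With [y v = d v - (k - 1) / 2]
    this reads [(k + 1) / 2 * \sum_v y v >= \sum_v (y v)^2 >= 0], hence
    [2 #|M| = \sum_v d v >= n (k - 1) / 2]. *)
Require Import Defs.
From mathcomp Require Import all_boot all_order all_algebra.
From mathcomp Require Import ring lra.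
Set Implicit Arguments.
Unset Strict Implicit.
Unset Printing Implicit Defensive.
Import Order.TTheory GRing.Theory Num.Theory.
Local Open Scope ring_scope.

(** [A] holds plain vertex sets, so that one notion serves both the image of a monopoly and the edge
    set with one edge deleted. *)
Definition nbhd_in (G : sgraph) (A : {set {set G}}) (v : G) : {set G} :=
  [set w in nbhd v | [set v; w] \in A].

Lemma mem_edges (G : sgraph) (v w : G) : adj v w -> [set v; w] \in edges G.
Proof. by move=> vw; apply/imsetP; exists (v, w); rewrite // inE. Qed.

Lemma adj_neq (G : sgraph) (v w : G) : adj v w -> v != w.
Proof. by apply: contraTneq => ->; rewrite adj_irr. Qed.

Lemma edgeP (G : sgraph) (e : {set G}) v :
  e \in edges G -> v \in e -> exists2 x, adj v x & e = [set v; x].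
Proof.
case/imsetP=> -[a b]; rewrite inE /= => ab ->; rewrite !inE.
case/orP=> /eqP->; first by exists b.
by exists a; rewrite 1?adj_sym // setUC.
Qed.

Lemma set2_injr (T : finType) (v : T) : injective (fun x => [set v; x]).
Proof.
move=> x y /setP E; have := E x; rewrite !inE eqxx orbT.
case/esym/orP => /eqP // xv; have := E y.
by rewrite !inE eqxx orbT xv orbb => /eqP.
Qed.

(** The members of [A] through [v] and those through [w] are disjoint families: an edge through both
    is [[set v; w]], which is not in [A]. Each family is counted by the other endpoints. *)
Lemma card_edges_meeting (G : sgraph) (A : {set {set G}}) (v w : G) :
    A \subset edges G -> v != w -> [set v; w] \notin A ->
  #|[set f in A | [set v; w] :&: f != set0]| =
  (#|nbhd_in A v| + #|nbhd_in A w|)%N.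
Proof.
move=> /subsetP sAE neq_vw notA.
have -> : [set f in A | [set v; w] :&: f != set0] =
    [set [set v; x] | x in nbhd_in A v] :|: [set [set w; x] | x in nbhd_in A w].
  apply/setP=> f; rewrite !inE; apply/andP/orP.
    case=> Af /set0Pn[x]; rewrite !inE => /andP[/orP[]/eqP-> xf];
      have [y xy Ef] := edgeP (sAE _ Af) xf; [left|right];
      by apply/imsetP; exists y; rewrite // !inE xy -Ef.
  case=> /imsetP[x]; rewrite !inE => /andP[_ Af] ->; split=> //; apply/set0Pn.
    by exists v; rewrite !inE eqxx.
  by exists w; rewrite !inE eqxx orbT.
rewrite cardsU !card_imset; try exact: set2_injr.
rewrite [X in (_ - X)%N](_ : _ = 0%N) ?subn0 //; apply/eqP; rewrite cards_eq0.
apply/eqP/setP=> f; rewrite !inE; apply/negP=> /andP[].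
case/imsetP=> x; rewrite !inE => /andP[_ Af] Ef.
case/imsetP=> y _ Ey; have : w \in f by rewrite Ey !inE eqxx.
rewrite Ef !inE eq_sym (negPf neq_vw) /= => /eqP wx.
by move: notA; rewrite wx Af.
Qed.

(** Moves neighbour counts from the line graph to edge sets of [G]; deleting [s] reflects that no
    edge is adjacent to itself. *)
Lemma card_line_nbhd (G : sgraph) (M : {set line_graph G}) (e : line_graph G) s :
  val e = s -> #|nbhd e :&: M| = #|[set f in val @: M :\ s | s :&: f != set0]|.
Proof.
move=> <-; rewrite -(card_imset _ (@val_inj _ _ (edge G))); congr #|pred_of_set _|.
apply/setP=> f; rewrite !inE; apply/imsetP/andP.
  case=> g; rewrite !inE => /andP[/andP[neq meet] gM] ->; split=> //.
  by rewrite (inj_eq val_inj) eq_sym neq imset_f.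
case=> /andP[neq /imsetP[g gM Ef]] meet; exists g; rewrite // !inE gM andbT.
by rewrite /= /line_adj -Ef meet andbT -(inj_eq val_inj) -Ef eq_sym.
Qed.

Lemma val_image_edges (G : sgraph) (M : {set line_graph G}) :
  val @: M \subset edges G.
Proof. by apply/subsetP=> f /imsetP[g _ ->]; exact: (valP g). Qed.

Lemma deg_line (G : sgraph) k (hk : regular G k) (e : line_graph G) (v w : G) :
  adj v w -> val e = [set v; w] -> deg e = (k.-1 + k.-1)%N.
Proof.
(* Deleting the edge [e] removes exactly [y] from the [k] neighbours of [x]. *)
have nbhd_del (x y : G) : adj x y -> val e = [set x; y] ->
    #|nbhd_in (val @: [set: line_graph G] :\ val e) x| = k.-1.
  move=> xy Ee; rewrite -(hk x) /deg [in RHS](cardsD1 y) inE xy /=.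
  congr #|pred_of_set _|; apply/setP=> z; rewrite !inE Ee.
  rewrite (inj_eq (@set2_injr _ x)) andbCA; case: (boolP (adj x z)) => xz.
    rewrite andbT /=; case: (z != y) => //=.
    by apply/imsetP; exists (exist (fun f => f \in edges G) _ (mem_edges xz)); rewrite ?inE.
  by rewrite andbF.
(* The degree is the neighbour count inside the full vertex set of the line graph. *)
move=> vw Ee; rewrite /deg -[nbhd e]setIT (card_line_nbhd _ Ee).
rewrite card_edges_meeting ?adj_neq //.
- by rewrite -Ee (nbhd_del v w) ?(nbhd_del w v) // 1?adj_sym // setUC.
- by rewrite (subset_trans (subsetDl _ _)) ?val_image_edges.
- by rewrite !inE eqxx.
Qed.

(** The left side counts ordered adjacent pairs, grouped here by the edge they span. Members of [A]
    that are not edges contribute nothing, hence only an inequality. *)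
Lemma sum_nbhd_in (G : sgraph) (A : {set {set G}}) :
  (\sum_v #|nbhd_in A v| <= 2 * #|A|)%N.
Proof.
have -> : (\sum_v #|nbhd_in A v| =
    \sum_(f in A) #|[set p : G * G | adj p.1 p.2 && ([set p.1; p.2] == f)]|)%N.
  transitivity (\sum_(p : G * G | adj p.1 p.2 && ([set p.1; p.2] \in A)) 1)%N.
    rewrite -(pair_big_dep xpredT (fun v w => adj v w && ([set v; w] \in A))
      (fun _ _ => 1%N)) /=.
    by apply: eq_bigr => v _; rewrite -sum1_card; apply: eq_bigl => w; rewrite !inE.
  rewrite (partition_big (fun p => [set p.1; p.2]) (mem A)); last by move=> p /andP[].
  apply: eq_bigr => f Af; rewrite -sum1_card; apply: eq_bigl => p; rewrite inE.
  by case: eqP => [->|]; rewrite ?andbF // (Af : f \in A) andbT.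
rewrite mulnC -sum_nat_const; apply: leq_sum => f _.
have [->|[[a b]]] := set_0Vmem [set p : G * G | adj p.1 p.2 && ([set p.1; p.2] == f)].
  by rewrite cards0.
rewrite inE /= => /andP[ab /eqP <-].
(* The only pairs spanning [[set a; b]] are its two orientations. *)
apply: (@leq_trans #|[set (a, b); (b, a)]|); last by rewrite cards2 ltnS leq_b1.
apply: subset_leq_card; apply/subsetP=> -[x y]; rewrite !inE /=.
case/andP=> xy /eqP/setP E; have := E x; have := E y; have := E a.
have := adj_neq xy; have := adj_neq ab; rewrite !inE !xpair_eqE !eqxx ?orbT /=.
move=> nab nxy _ /esym/orP[]/eqP Ey /esym/orP[]/eqP Ex; move: nxy;
  by rewrite Ex Ey ?eqxx ?orbT.
Qed.

Lemma sum_nbhd_in_ge (G : sgraph) k (A : {set {set G}}) :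
    regular G k ->
    (forall v w : G, adj v w -> [set v; w] \notin A ->
       k%:R - 1 <= #|nbhd_in A v|%:R + #|nbhd_in A w|%:R :> rat) ->
  #|G|%:R * (k%:R - 1) / 2 <= \sum_v #|nbhd_in A v|%:R :> rat.
Proof.
move=> hk hA; pose d v : rat := #|nbhd_in A v|%:R.
pose out v w := adj v w && ([set v; w] \notin A).
have outC v w : out v w = out w v by rewrite /out adj_sym setUC.
have sum_out c v : \sum_(w | out v w) c = (k%:R - d v) * c.
  rewrite sumr_const -[LHS]mulr_natl; congr (_ * _); apply/eqP.
  rewrite eq_sym subr_eq -natrD -(hk v) /deg; apply/eqP; congr _%:R.
  rewrite -(cardsID [set w | [set v; w] \in A]) addnC; congr (_ + _)%N.
    by apply: eq_card => w; rewrite !inE andbC.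
  by apply: eq_card => w; rewrite !inE.
(* Summing over ordered pairs counts every edge outside [A] twice; by the symmetry of [out], the
   terms [d v] and [d w] then have equal totals. *)
have: \sum_v \sum_(w | out v w) (k%:R - 1) <=
      \sum_v \sum_(w | out v w) (d v + d w).
  by apply: ler_sum => v _; apply: ler_sum => w /andP[vw nA]; exact: hA.
have -> : \sum_v \sum_(w | out v w) (d v + d w) =
    \sum_v (k%:R - d v) * d v + \sum_v (k%:R - d v) * d v.
  under eq_bigr do rewrite big_split /= sum_out.
  rewrite big_split /=; congr (_ + _).
  rewrite (exchange_big_dep xpredT) //=; apply: eq_bigr => w _.
  by rewrite -sum_out; apply: eq_bigl => v; rewrite outC.
under eq_bigr do rewrite sum_out.
rewrite -big_split /= -subr_ge0 -sumrB => sum_ge0.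
pose y v : rat := d v - (k%:R - 1) / 2.
(* With [d v = y v + (k - 1) / 2], the summand at [v] becomes [(k + 1) * y v - 2 * y v ^+ 2], so
   dropping the square only increases the sum. *)
have : 0 <= \sum_v (k%:R + 1) * y v.
  apply: le_trans sum_ge0 _; apply: ler_sum => v _; rewrite -subr_ge0.
  have -> : (k%:R + 1) * y v -
      ((k%:R - d v) * d v + (k%:R - d v) * d v - (k%:R - d v) * (k%:R - 1)) =
      2 * y v ^+ 2 by rewrite /y; field.
  by rewrite mulr_ge0 ?sqr_ge0.
rewrite -mulr_sumr pmulr_rge0 ?ltr_wpDl ?ler0n // sumrB subr_ge0.
by rewrite sumr_const -[leLHS]mulr_natl mulrA.
Qed.

Lemma monopoly_line_threshold (G : sgraph) k (M : {set line_graph G}) (v w : G) :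
    regular G k -> monopoly (@majority (line_graph G)) M ->
    adj v w -> [set v; w] \notin val @: M ->
  k%:R - 1 <= #|nbhd_in (val @: M) v|%:R + #|nbhd_in (val @: M) w|%:R :> rat.
Proof.
move=> hk /forallP monM vw notM.
pose e : line_graph G :=
  exist (fun f => f \in edges G) _ (mem_edges vw).
have Ee : val e = [set v; w] by [].
have eM : e \notin M by apply: contra notM => eM; rewrite -Ee imset_f.
have := monM e; rewrite eM /= /majority (deg_line hk vw Ee).
rewrite (card_line_nbhd _ Ee).
(* The edge lies outside the monopoly, so deleting it changes nothing. *)
have -> : val @: M :\ [set v; w] = val @: M.
  by apply/setDidPl; rewrite disjoint_sym disjoints1.
rewrite card_edges_meeting ?val_image_edges ?adj_neq // -natrD.
have -> : (k.-1 + k.-1)%:R / 2 = k.-1%:R :> rat by rewrite natrD; field.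
(* The predecessor is truncated: at [k = 0] it is 0, while the rational bound is -1. *)
apply: le_trans; case: k {hk} => [|k] /=; first by rewrite sub0r lerN10.
by rewrite -natr1 addrK.
Qed.

Theorem theorem4 (G : sgraph) (n k : nat) (hn : #|G| = n) (hk : regular G k) :
  (mo (line_graph G))%:R >= n%:R * (k%:R - 1) / 4 :> rat.
Proof.
rewrite /mo; have [[M monM <-] _] := min_monopolyP (@majority (line_graph G)).
have ge := sum_nbhd_in_ge hk
  (fun v w => @monopoly_line_threshold G k M v w hk monM).
have le : \sum_v #|nbhd_in (val @: M) v|%:R <= 2 * #|M|%:R :> rat.
  have := sum_nbhd_in (val @: M); rewrite (card_imset _ (@val_inj _ _ (edge G))).
  by rewrite -(ler_nat rat) natrM natr_sum.
by move: (le_trans ge le); rewrite hn; lra.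
Qed.
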